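(* For $m,n\in\mathbb{N}$ and integer $\ell\geqslant 0$, $$|\mathcal{B}_{n,\ell,m}|=c(n+\ell,\ell+1,m),$$ and consequently $|\mathcal{B}_{n,\ell}|=c(n+\ell,\ell+1)$.
   Context: $\mathbb{N}=\{1,2,\ldots\}$. For $\ell\geqslant 0$, a finite set $A\subset\mathbb{N}$ is $\ell$-strong Schreier if $A=\emptyset$ or $\min A\geqslant \ell|A|-\ell+1$. $\mathcal{B}_{n,\ell}=\{B\subset\{1,\ldots,n\}: n\in B,\ B\text{ is } \ell\text{-strong Schreier}\}$ and $\mathcal{B}_{n,\ell,m}=\{B\in\mathcal{B}_{n,\ell}: |B|=m\}$. $c(u,v,s)$ is the number of compositions (ordered sums) of $u$ into exactly $s$ positive parts each at least $v$, and $c(u,v)$ is the number of compositions of $u$ into parts each at least $v$. *)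

(* Defs.v *)
From mathcomp Require Import all_boot finmap.
Set Implicit Arguments.
Unset Strict Implicit.
Unset Printing Implicit Defensive.
Local Open Scope fset_scope.

(* The minimum of a nonempty finite set of naturals (0 on the empty set). *)
Definition fset_min (A : {fset nat}) : nat := head 0 (sort leq A).

Lemma fset_minP (A : {fset nat}) : A != fset0 ->
  fset_min A \in A /\ {in A, forall a, fset_min A <= a}.
Proof.
move=> A0; rewrite /fset_min.
have memA a : (a \in sort leq A) = (a \in A) by rewrite mem_sort.
have sA : sorted leq (sort leq A) by apply: sort_sorted; exact: leq_total.
case: (sort leq A) memA sA => [|x s] memA sA.
  by have /fset0Pn[a] := A0; rewrite -memA.
split=> [|a]; first by rewrite -memA mem_head.
rewrite -memA inE => /predU1P[->//|sa].
by move: sA => /= /(order_path_min leq_trans)/allP/(_ _ sa).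
Qed.

(* The truncated subtraction is exact: #|` A| >= 1 in the second disjunct.
   The bound being positive, 0 never belongs to such an A, so these are finite
   sets of positive integers. *)
Definition strong_schreier (l : nat) (A : {fset nat}) : bool :=
  (A == fset0) || (l * #|` A| - l + 1 <= fset_min A).

Definition schreier_sets (n l : nat) : {fset {fset nat}} :=
  [fset B in fpowerset [fset k in iota 1 n] | (n \in B) && strong_schreier l B].

Definition schreier_sets_card (n l m : nat) : {fset {fset nat}} :=
  [fset B in schreier_sets n l | #|` B| == m].

Definition is_composition (u : nat) (s : seq nat) : bool :=
  all (leq 1) s && (sumn s == u).

(* A composition of u has at most u parts, each at most u, so compositions of u
   are carried by the finite type of sequences over 'I_u.+1 of length at most u
   (see compositionP). *)
Definition parts (u : nat) (s : {bseq u of 'I_u.+1}) : seq nat :=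
  [seq val i | i <- s].

Lemma parts_inj u : injective (@parts u).
Proof. by move=> s t /(inj_map val_inj) /val_inj. Qed.

Lemma compositionP u (s : seq nat) :
  is_composition u s -> exists t : {bseq u of 'I_u.+1}, parts t = s.
Proof.
case/andP=> /allP pos_s /eqP sum_s.
have le_su : size s <= u.
  rewrite -{}sum_s; elim: s pos_s => //= a s IHs pos_s.
  rewrite -add1n leq_add //; first by rewrite pos_s ?mem_head.
  by apply: IHs => b sb; rewrite pos_s // inE sb orbT.
have lt_s : all (fun a => a < u.+1) s.
  apply/allP=> a; rewrite ltnS -{}sum_s {pos_s le_su}.
  elim: s => //= b s IHs; rewrite inE => /predU1P[->|/IHs]; first exact: leq_addr.
  by move/leq_trans; apply; exact: leq_addl.
have sz : size (map (@inord u) s) <= u by rewrite size_map.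
exists (Bseq sz); rewrite /parts /= -map_comp -[RHS]map_id.
by apply/eq_in_map=> a sa /=; rewrite inordK ?(allP lt_s).
Qed.

Definition num_compositions (u v : nat) : nat :=
  #|[set s : {bseq u of 'I_u.+1} |
      is_composition u (parts s) && all (leq v) (parts s)]|.

Definition num_compositions_size (u v k : nat) : nat :=
  #|[set s : {bseq u of 'I_u.+1} |
      [&& is_composition u (parts s), all (leq v) (parts s)
        & size (parts s) == k]]|.

(* Main.v *)
Require Import Defs.
From mathcomp Require Import all_boot finmap zify.
Local Open Scope fset_scope.
Local Open Scope nat_scope.

(** Write [B = {b_1 < ... < b_m}] with [b_m = n] and put [b_0 = l m - l].  The
    Schreier condition on [B] says exactly that [b_0 < b_1], so the increments
    [a_i = b_i - b_{i-1} + l] are all at least [l + 1], and they add up to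
    [n - (l m - l) + l m = n + l].  Conversely [B] is recovered from
    [a_1, ..., a_m] by partial sums, which gives a bijection preserving the
    number of parts. *)

Definition shifted_sums (l x : nat) (s : seq nat) : seq nat :=
  scanl (fun x a => x + (a - l)) x s.

Definition shifted_increments (l x : nat) (t : seq nat) : seq nat :=
  pairmap (fun a b => b - a + l) x t.

Lemma size_shifted_sums l x s : size (shifted_sums l x s) = size s.
Proof. exact: size_scanl. Qed.

Lemma size_shifted_increments l x t : size (shifted_increments l x t) = size t.
Proof. exact: size_pairmap. Qed.

Lemma path_shifted_sums l x s :
  all (leq (l + 1)) s -> path ltn x (shifted_sums l x s).
Proof.
by elim: s x => //= a s IHs x /andP[la ls]; rewrite IHs // andbT; lia.
Qed.

Lemma all_shifted_increments l x t :
  path ltn x t -> all (leq (l + 1)) (shifted_increments l x t).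
Proof.
by elim: t x => //= a t IHt x /andP[xa pt]; rewrite IHt // andbT; lia.
Qed.

(** Every part exceeds [l], so the truncated [a - l] is exact and adding [l] back to the difference
    of neighbours restores [a]. *)
Lemma shifted_sumsK l x s : all (leq (l + 1)) s ->
  shifted_increments l x (shifted_sums l x s) = s.
Proof.
elim: s x => //= a s IHs x /andP[la ls].
rewrite /shifted_increments /= -/(shifted_increments _ _ _) IHs //.
by congr cons; lia.
Qed.

Lemma shifted_incrementsK l x t : path ltn x t ->
  shifted_sums l x (shifted_increments l x t) = t.
Proof.
elim: t x => //= a t IHt x /andP[xa pt].
have xaE : x + (a - x + l - l) = a by lia.
by rewrite /shifted_sums /= -/(shifted_sums _ _ _) xaE IHt.
Qed.

(** Each part raises the running value by itself minus [l], and these increments telescope. The term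
    [l * size s] stands on the left to avoid truncated subtraction. *)
Lemma last_shifted_sums l x s : all (leq (l + 1)) s ->
  last x (shifted_sums l x s) + l * size s = x + sumn s.
Proof.
elim: s x => [|a s IHs] x /=; first by lia.
by case/andP=> la /(IHs (x + (a - l))); rewrite /shifted_sums; lia.
Qed.

Lemma sort_fset_ltn_sorted (B : {fset nat}) : sorted ltn (sort leq B).
Proof.
by rewrite ltn_sorted_uniq_leq sort_uniq fset_uniq sort_sorted //; exact: leq_total.
Qed.

Lemma sort_fset_seq (t : seq nat) :
  sorted ltn t -> sort leq [fset x in t] = t.
Proof.
move=> st; apply: (irr_sorted_eq ltn_trans ltnn) => //.
  exact: sort_fset_ltn_sorted.
by move=> x; rewrite mem_sort inE.
Qed.

Lemma fset_seq_sort (B : {fset nat}) : [fset x in sort leq B] = B.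
Proof. by apply/fsetP=> x; rewrite inE mem_sort. Qed.

Lemma path_leq_last x (t : seq nat) y : path leq x t -> y \in t -> y <= last x t.
Proof.
elim: t x y => //= a t IHt x y /andP[_ pt]; rewrite inE => /predU1P[->|]; last exact: IHt.
case: t pt IHt => // b t pt IHt.
have /andP[ab _] := pt.
by apply: leq_trans ab _; apply: IHt pt _; rewrite mem_head.
Qed.

(** In increasing order the Schreier bound is a strict step from b_0 to the first element, which
    also makes all elements positive. The last element is the maximum, so its being [n] encodes both
    [n \in B] and the upper bound [n] on [B]. *)
Lemma in_schreier_sets n l (B : {fset nat}) : 0 < n ->
  (B \in schreier_sets n l) =
  path ltn (l * #|` B| - l) (sort leq B)
    && (last (l * #|` B| - l) (sort leq B) == n).
Proof.
move=> n_gt0; rewrite !inE fpowersetE /strong_schreier /fset_min /=.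
have memB x : (x \in sort leq B) = (x \in B) by rewrite mem_sort.
have sB := sort_fset_ltn_sorted B.
have szB : size (sort leq B) = #|` B| by rewrite size_sort.
have B0 : (B == fset0) = (size (sort leq B) == 0) by rewrite szB cardfs_eq0.
rewrite B0 -szB; set t := sort leq B in memB sB *.
have subB : (B `<=` [fset k in iota 1 n]) = all (fun k => 0 < k <= n) t.
  apply/fsubsetP/allP=> sub x xB.
    by have := sub x; rewrite -memB xB !inE mem_iota => /(_ isT); lia.
  by have := sub x; rewrite memB xB !inE mem_iota => /(_ isT); lia.
rewrite subB -memB.
(* For empty [B], [last] falls back to [l * 0 - l = 0], which differs from [n > 0], so both sides
   are false. *)
case: t sB {memB szB B0 subB} => [|a t] /= pt; first by rewrite muln0; lia.
set c := l * (size t).+1 - l.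
have ptl : path leq a t by apply: sub_path pt => x y /ltnW.
have lt_le x : x \in a :: t -> a <= x <= last a t.
  rewrite inE => /predU1P[->|tx].
    rewrite leqnn /=; case/lastP: (t) ptl => // t' y.
    rewrite last_rcons => /(order_path_min leq_trans)/allP; apply.
    by rewrite mem_rcons mem_head.
  by rewrite (allP (order_path_min leq_trans ptl)) //= path_leq_last.
rewrite pt andbT; apply/idP/idP.
  case/and3P=> /andP[an /allP tn] nt ca.
  have /andP[_ n_le] := lt_le _ nt; rewrite -addn1 ca eqn_leq n_le andbT /=.
  by have := mem_last a t; rewrite inE => /predU1P[->|/tn /andP[]//]; case/andP: an.
case/andP=> ca /eqP nE; rewrite addn1 ca andbT -nE mem_last andbT.
have in_range x : x \in a :: t -> 0 < x <= last a t.
  by case/lt_le/andP=> ax ->; rewrite andbT; apply: leq_trans ax; lia.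
rewrite in_range ?mem_head //=; apply/allP=> x tx.
by apply: in_range; rewrite inE tx orbT.
Qed.

(** The bijection preserves the number of parts, so any condition [P] on that number is carried
    along; [pred1 m] and [predT] yield the two counts. *)
Lemma card_schreier_compositions n l (P : pred nat) : 0 < n ->
  #|` [fset B in schreier_sets n l | P #|` B| ]| =
  #|[set s : {bseq n + l of 'I_(n + l).+1} |
      [&& is_composition (n + l) (parts s), all (leq (l + 1)) (parts s)
        & P (size (parts s))]]|.
Proof.
move=> n_gt0; set C := [set s | _].
pose sums s := shifted_sums l (l * size s - l) s.
pose F (s : {bseq n + l of 'I_(n + l).+1}) := [fset x in sums (parts s)].
have sumsP s : all (leq (l + 1)) s -> sorted ltn (sums s).
  by move=> ls; apply: path_sorted (path_shifted_sums l _ s ls).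
have FK s : s \in C -> sort leq (F s) = sums (parts s).
  by rewrite inE => /and3P[_ ls _]; rewrite sort_fset_seq ?sumsP.
have cardF s : s \in C -> #|` F s| = size (parts s).
  by move=> /FK /(congr1 size); rewrite size_sort size_shifted_sums.
have injF : {in C &, injective F}.
  move=> s1 s2 C1 C2 eqF; apply: parts_inj.
  (* The starting value of [sums] depends on the length, so the lengths must agree before
     [shifted_increments] from one common start can undo both sums. *)
  have eqs : size (parts s1) = size (parts s2) by rewrite -!cardF ?eqF.
  have : sums (parts s1) = sums (parts s2) by rewrite -!FK ?eqF.
  move: C1 C2; rewrite !inE => /and3P[_ l1 _] /and3P[_ l2 _]; rewrite /sums eqs.
  by move/(congr1 (shifted_increments l (l * size (parts s2) - l))); rewrite !shifted_sumsK.
have -> : [fset B in schreier_sets n l | P #|` B|] = [fset F s | s in C].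
  apply/fsetP=> B; rewrite in_fset /= inE /= in_schreier_sets //.
  apply/idP/imfsetP=> /= [/andP[/andP[pB /eqP lastB] PB]|[s Cs ->]].
    set c := l * #|` B| - l in pB lastB.
    pose s := shifted_increments l c (sort leq B).
    have sz_s : size s = #|` B| by rewrite size_shifted_increments size_sort.
    have ls : all (leq (l + 1)) s by exact: all_shifted_increments.
    have sumsE : shifted_sums l c s = sort leq B by exact: shifted_incrementsK.
    (* Nonemptiness makes the subtraction in [c] exact, so that the increments total n - c + l|B| =
       n + l. *)
    have B_gt0 : 0 < #|` B|.
      rewrite lt0n; apply/eqP=> B0; move: lastB; rewrite /c B0 muln0.
      by have /size0nil-> : size (sort leq B) = 0; [rewrite size_sort | rewrite /=; lia].
    have le_l : l <= l * #|` B| by rewrite leq_pmulr.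
    have comp_s : is_composition (n + l) s.
      apply/andP; split; first by apply: sub_all ls => x; lia.
      by have := last_shifted_sums l c s ls; rewrite sumsE lastB sz_s /c; lia.
    have [u uE] := compositionP comp_s.
    exists u; first by rewrite inE uE comp_s ls sz_s.
    by rewrite /F uE /sums sz_s sumsE fset_seq_sort.
  rewrite FK // cardF //; move: Cs; rewrite inE => /and3P[/andP[_ /eqP sum_s] ls ->].
  rewrite andbT path_shifted_sums //=.
  have := last_shifted_sums l (l * size (parts s) - l) _ ls; rewrite sum_s -/(sums _).
  (* A composition of [n + l > 0] has a part, so with m parts the start l m - l is exact and the
     last partial sum is (l m - l) + (n + l) - l m = n. *)
  have s_gt0 : 0 < size (parts s) by case: (parts s) sum_s => //=; lia.
  by have : l <= l * size (parts s) by [rewrite leq_pmulr]; lia.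
by rewrite card_in_imfset //= cardE.
Qed.

Theorem theorem1p9 (n l : nat) (n_gt0 : 0 < n) :
  (forall m : nat, 0 < m ->
     #|` schreier_sets_card n l m| = num_compositions_size (n + l) (l + 1) m)
  /\ #|` schreier_sets n l| = num_compositions (n + l) (l + 1).
Proof.
split=> [m _|]; first exact: (card_schreier_compositions n l (pred1 m) n_gt0).
have := card_schreier_compositions n l predT n_gt0.
rewrite /num_compositions; set S := [fset B in _ | _].
have -> : S = schreier_sets n l by apply/fsetP=> B; rewrite in_fset /= inE /= andbT.
by move=> ->; apply: eq_card => s; rewrite !inE andbT.
Qed.
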